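(* Let $X,Z$ be compact metric spaces with a uniformly contractive iterated function system $\{\tau_x:Z\to Z\}_{x\in X}$, and let $\alpha\in\mathcal{P}(X)$ have full support. Let $c:X\times Z\to\mathbb{R}$ be Lipschitz. Then $P_\alpha(c)=\log(\lambda_c)$, where $\lambda_c$ is the unique positive eigenvalue of $L_{c,\alpha}$ associated to a positive eigenfunction $h$. Moreover, if $\pi$ is the holonomic probability associated to the normalized function $\overline{c}(x,z):=c(x,z)+\log h(\tau_x(z))-\log h(z)-\log\lambda_c$, then $$P_\alpha(c)=\int c\,d\pi+H_\alpha(\pi).$$
   Context: $\mathcal{P}(S)$ is the set of Borel probability measures on a compact metric space $S$, and $C(S)$ the space of continuous real functions on $S$. Uniformly contractive means: there is a constant $0<\gamma<1$ with $d(\tau_{x_1}(z_1),\tau_{x_2}(z_2))\le\gamma[d(x_1,x_2)+d(z_1,z_2)]$ for all $x_i\in X$, $z_i\in Z$. Lipschitz on $X\times Z$ refers to the metric $d(x_1,x_2)+d(z_1,z_2)$. For Lipschitz $c:X\times Z\to\mathbb{R}$, $L_{c,\alpha}:C(Z)\to C(Z)$ is $L_{c,\alpha}(u)(z)=\int e^{c(x,z)}u(\tau_x(z))\,d\alpha(x)$. It has a unique positive eigenvalue $\lambda_c$ admitting a strictly positive continuous eigenfunction $h$; $h$ is Lipschitz and unique up to a multiplicative constant (''positive eigenfunction'' means strictly positive and continuous). A Lipschitz function $c$ is normalized if $L_{c,\alpha}(1)=1$; the function $\overline{c}$ in the claim is normalized. If $c$ is normalized, there is a unique $\rho\in\mathcal{P}(Z)$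 with $\int L_{c,\alpha}(u)\,d\rho=\int u\,d\rho$ for all $u\in C(Z)$, and the holonomic probability associated to $c$ is $\pi\in\mathcal{P}(X\times Z)$ defined by $\int g\,d\pi=\int\int e^{c(x,z)}g(x,z)\,d\alpha(x)\,d\rho(z)$ for $g\in C(X\times Z)$. $\Pi(\tau)$ is the set of holonomic probabilities: those $\pi\in\mathcal{P}(X\times Z)$ with $\int g(\tau_x(z))\,d\pi(x,z)=\int g(z)\,d\pi(x,z)$ for all $g\in C(Z)$. For $\pi\in\Pi(\tau)$, $$H_\alpha(\pi)=-\sup\Big\{\int b\,d\pi \;:\; b:X\times Z\to\mathbb{R}\text{ Lipschitz},\ L_{b,\alpha}(1)=1\Big\}\in[-\infty,0],$$ and $P_\alpha(c)=\sup_{\pi\in\Pi(\tau)}\big[\int c\,d\pi+H_\alpha(\pi)\big]$. *)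

(* Defs.v *)
From HB Require Import structures.
From mathcomp Require Import all_boot all_order all_algebra.
From mathcomp Require Import all_classical all_reals all_analysis.

Set Implicit Arguments.
Unset Strict Implicit.
Unset Printing Implicit Defensive.

Import Order.TTheory GRing.Theory Num.Theory.
Import numFieldNormedType.Exports.

Local Open Scope classical_set_scope.
Local Open Scope ring_scope.

(* A nonempty metric space: [measurableType] requires a point, which otherwise
   plays no role. *)
#[short(type="pmetricType")]
HB.structure Definition PointedMetric (R : numDomainType) :=
  {T of Metric R T & isPointed T}.

(* [T] with its Borel sigma-algebra; for [T := X * Z] the open sets are those of
   the product topology. *)
Notation borel T := (@g_sigma_algebraType T%type open).

Section ThermodynamicFormalism.
Variables (R : realType) (X Z : pmetricType R).

Definition uniformly_contractive (tau : X -> Z -> Z) : Prop :=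
  exists2 gamma : R, 0 < gamma < 1 & forall x1 x2 z1 z2,
    mdist (tau x1 z1) (tau x2 z2) <= gamma * (mdist x1 x2 + mdist z1 z2).

(* The library's [lipschitz] needs a normed module as domain, and its product
   pseudometric is the max; here the metric on X * Z is the sum. *)
Definition sum_lipschitz (f : X * Z -> R) : Prop :=
  exists K : R, forall x1 x2 z1 z2,
    `|f (x1, z1) - f (x2, z2)| <= K * (mdist x1 x2 + mdist z1 z2).

Definition full_support (alpha : probability (borel X) R) : Prop :=
  forall U : set X, open U -> U !=set0 -> (0 < alpha U)%E.

Variables (tau : X -> Z -> Z) (alpha : probability (borel X) R).

(* L_{c,alpha}; only its values at continuous [u] are meaningful. *)
Definition transfer (c : X * Z -> R) (u : Z -> R) (z : Z) : R :=
  \int[alpha]_x (expR (c (x, z)) * u (tau x z)).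

Definition positive_eigenpair (c : X * Z -> R) (lambda : R) (h : Z -> R) :=
  [/\ 0 < lambda, continuous h, forall z, 0 < h z &
      forall z, transfer c h z = lambda * h z].

Definition normalized (b : X * Z -> R) : Prop :=
  sum_lipschitz b /\ forall z, transfer b (fun=> 1) z = 1.

Definition holonomic (p : probability (borel (X * Z)) R) : Prop :=
  forall g : Z -> R, continuous g ->
    \int[p]_w g (tau w.1 w.2) = \int[p]_w g w.2.

Definition dual_invariant (c : X * Z -> R) (rho : probability (borel Z) R) :=
  forall u : Z -> R, continuous u ->
    \int[rho]_z transfer c u z = \int[rho]_z u z.

(* Meant for normalized [c], in which case such a [rho] is unique. *)
Definition holonomic_associated (c : X * Z -> R)
    (p : probability (borel (X * Z)) R) : Prop :=
  exists2 rho : probability (borel Z) R, dual_invariant c rho &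
    forall g : X * Z -> R, continuous g ->
      \int[p]_w g w
      = \int[rho]_z \int[alpha]_x (expR (c (x, z)) * g (x, z)).

Definition entropy (p : probability (borel (X * Z)) R) : \bar R :=
  (- ereal_sup [set (\int[p]_w b w)%:E | b in normalized])%E.

Definition pressure (c : X * Z -> R) : \bar R :=
  ereal_sup [set ((\int[p]_w c w)%:E + entropy p)%E | p in holonomic].

Definition normalization (c : X * Z -> R) (lambda : R) (h : Z -> R)
    (w : X * Z) : R :=
  c w + ln (h (tau w.1 w.2)) - ln (h w.2) - ln lambda.

End ThermodynamicFormalism.

(* Main.v *)
(* The normalization [b] of [c] is cohomologous to [c] up to [ln lambda], so
   [\int b dp = \int c dp - ln lambda] for every holonomic [p]. It is normalized
   because [ln \o h] is Lipschitz; being a competitor in the definition of the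
   entropy, it gives [P(c) <= ln lambda]. For [p] associated to [b], Gibbs'
   inequality makes [b] optimal in the entropy of [p], hence equality. Such a [p]
   exists by Krylov-Bogoliubov applied to the Markov operator [L_b], together
   with the Riesz-Markov theorem on compact pseudometric spaces, used once on [Z]
   and once on [X * Z]. *)
From HB Require Import structures.
Require Import Defs.
From mathcomp Require Import all_boot all_order all_algebra.
From mathcomp Require Import all_classical all_reals all_analysis.
From mathcomp Require Import measurable_realfun ring lra.

Set Implicit Arguments.
Unset Strict Implicit.
Unset Printing Implicit Defensive.

Import Order.TTheory GRing.Theory Num.Theory.
Import numFieldNormedType.Exports.

Local Open Scope classical_set_scope.
Local Open Scope ring_scope.

(** * Continuous real functions: measurability, integrability, cutoffs of open sets *)

Section ContinuousFunctions.
Context {R : realType}.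

Lemma continuousBr (T : topologicalType) (f g : T -> R) :
  continuous f -> continuous g -> continuous (fun x => f x - g x).
Proof. by move=> cf cg x; apply: cvgB; [exact: cf|exact: cg]. Qed.

Lemma continuousDr (T : topologicalType) (f g : T -> R) :
  continuous f -> continuous g -> continuous (fun x => f x + g x).
Proof. by move=> cf cg x; apply: cvgD; [exact: cf|exact: cg]. Qed.

Lemma continuousMr (T : topologicalType) (f g : T -> R) :
  continuous f -> continuous g -> continuous (fun x => f x * g x).
Proof. by move=> cf cg x; apply: cvgM; [exact: cf|exact: cg]. Qed.

Lemma continuous_cstr (T : topologicalType) (a : R) : continuous ((fun=> a) : T -> R).
Proof. by move=> x; exact: cvg_cst. Qed.

Lemma continuous_borel_measurable (T : ptopologicalType) (f : T -> R) :
  continuous f -> measurable_fun [set: borel T] f.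
Proof.
move=> cf; apply: (measurability _ (RGenOpens.measurableE R)) => _ [_ [a [b ->]] <-].
rewrite setTI; apply: sub_sigma_algebra.
by apply: open_comp; [move=> ? _; exact: cf|exact: interval_open].
Qed.

Lemma compact_continuous_bounded (T : topologicalType) (f : T -> R) :
  compact [set: T] -> continuous f ->
  exists2 M, 0 < M & forall x, `|f x| <= M.
Proof.
move=> cT cf.
have : compact (f @` [set: T]).
  by apply: continuous_compact => //; exact: continuous_subspaceT.
move=> /compact_bounded/ex_strict_bound_gt0[M M0 fM].
by exists M => // x; apply/ltW/fM; exists x.
Qed.

Lemma continuous_integrable (T : ptopologicalType) (mu : probability (borel T) R)
    (f : T -> R) : compact [set: T] -> continuous f ->
  mu.-integrable [set: borel T] (EFin \o f).
Proof.
move=> cT cf; apply: measurable_bounded_integrable => //.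
- by rewrite (le_lt_trans (probability_le1 mu measurableT)) ?ltry.
- exact: continuous_borel_measurable.
- have [M _ fM] := compact_continuous_bounded cT cf.
  exists M; split; first exact: num_real.
  by move=> N MN x _ /=; rewrite (le_trans (fM x))// ltW.
Qed.

Lemma Rintegral_probability_cst d (T : measurableType d)
    (mu : probability T R) (a : R) : \int[mu]_x a = a.
Proof.
rewrite Rintegral_cst// -[RHS]mulr1 -[X in _ = _ * X]/(fine 1%E).
by congr (_ * fine _); exact: probability_setT.
Qed.

(** The indicator of [U] is approached from below by Urysohn functions separating the complement of
    [U] from the points at depth [n.+1%:R^-1] inside [U]. The value [1] is reached at a finite
    stage, not just in the limit, which is what covers by functions require. *)
Lemma open_cutoff (T : pseudoMetricType R) (U : set T) : open U ->
  exists phi : nat -> T -> R,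
    [/\ forall n, continuous (phi n),
        forall n x, 0 <= phi n x <= 1,
        forall x, {homo phi ^~ x : m n / (m <= n)%N >-> m <= n},
        forall n x, ~ U x -> phi n x = 0
      & forall x, U x -> exists n, phi n x = 1].
Proof.
move=> oU.
pose A n := [set x : T | ball x n.+1%:R^-1 `<=` U].
have sep n : uniform_separator (~` U) (A n).
  apply: uniform_separatorW.
  exists [set xy : T * T | ball xy.1 n.+1%:R^-1 xy.2].
    rewrite -entourage_ballE; exists n.+1%:R^-1 => //=.
  rewrite -subset0 => -[x y] /= [[nUx Ay] /ball_sym bxy].
  exact/nUx/Ay.
pose psi n : T -> R := Urysohn (~` U) (A n).
have psi01 n x : 0 <= psi n x <= 1.
  by have := @Urysohn_range T R (~` U) (A n) (psi n x); apply; exists x.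
(* The Urysohn functions are chosen independently for each [n]; running maxima restore monotonicity.
   The index shifts by one: a point of [A n] gets value [1] at stage [n.+1]. *)
pose phi := fix phi n (x : T) : R :=
  if n is m.+1 then Num.max (phi m x) (psi m x) else 0.
have phiS n x : phi n.+1 x = Num.max (phi n x) (psi n x).
  by [].
have phi01 n x : 0 <= phi n x <= 1.
  elim: n => [|n /andP[p0 p1]]; first by rewrite /= lexx ler01.
  have /andP[s0 s1] := psi01 n x.
  by rewrite phiS le_max p0 ge_max p1 s1.
have ndphi x : {homo phi ^~ x : m n / (m <= n)%N >-> m <= n}.
  by apply/nondecreasing_seqP => n; rewrite phiS le_max lexx.
exists phi; split=> //.
- elim=> [|n cphi].
    exact: cst_continuous.
  rewrite (_ : phi n.+1 = (phi n) \max (psi n)); last exact/funext/phiS.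
  by move=> x; apply: continuous_max; [exact: cphi|exact: Urysohn_continuous].
- move=> n x nUx; elim: n => [|n IH]; first by [].
  rewrite phiS IH; have := @Urysohn_sub0 T R _ _ (sep n) (psi n x).
  by rewrite /psi /= => ->; [rewrite maxxx|exists x].
- move=> x Ux.
  have : nbhs x U by apply: open_nbhs_nbhs.
  rewrite -nbhs_ballE => -[e /= e0 eU].
  have [n ne] : exists n, n.+1%:R^-1 < e.
    have /= [n _ /(_ n) ] := near_infty_natSinv_lt (PosNum e0).
    by move=> /(_ (leqnn n)) ?; exists n.
  exists n.+1; apply/eqP; rewrite eq_le (andP (phi01 _ _)).2 andTb phiS le_max.
  apply/orP; right; have := @Urysohn_sub1 T R _ _ (sep n) (psi n x).
  rewrite /psi /= => ->//; exists x => //.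
  by apply: subset_trans eU; exact/le_ball/ltW.
Qed.

End ContinuousFunctions.

(** * The Riesz-Markov theorem on a compact pseudometric space *)

Section RieszMarkov.
Context {R : realType} {T : pseudoPMetricType R}.
Hypothesis compactT : compact [set: T].

(** Positive normalized linear functionals on C(T). They take arbitrary functions, but the laws bind
    only continuous arguments, which spares a separate type for C(T). *)
Definition state (L : (T -> R) -> R) :=
  [/\ forall (a : R) (f g : T -> R), continuous f -> continuous g ->
        L (fun x => a * f x + g x) = a * L f + L g,
      forall f : T -> R, continuous f -> (forall x, 0 <= f x) -> 0 <= L f
    & L (fun=> 1) = 1].

Variable L : (T -> R) -> R.
Hypothesis stateL : state L.

Lemma stateD (f g : T -> R) : continuous f -> continuous g ->
  L (fun x => f x + g x) = L f + L g.
Proof.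
have [lin _ _] := stateL => cf cg; rewrite -[L f]mul1r -lin//.
by congr L; apply/funext => x; rewrite mul1r.
Qed.

Lemma state0 : L (fun=> 0) = 0.
Proof.
have := stateD (@continuous_cstr R T 0) (@continuous_cstr R T 0).
rewrite (_ : (fun=> 0 + 0) = (fun=> 0)); last by apply/funext => x; rewrite addr0.
by move/eqP; rewrite -subr_eq subrr => /eqP.
Qed.

Lemma stateZ a (f : T -> R) : continuous f -> L (fun x => a * f x) = a * L f.
Proof.
have [lin _ _] := stateL => cf; rewrite -[RHS]addr0 -state0 -lin//.
  by congr L; apply/funext => x; rewrite addr0.
exact: continuous_cstr.
Qed.

Lemma state_cst a : L (fun=> a) = a.
Proof.
have [_ _ L1] := stateL; rewrite -[RHS]mulr1 -L1 -stateZ.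
  by congr L; apply/funext => x; rewrite mulr1.
exact: continuous_cstr.
Qed.

Lemma stateB (f g : T -> R) : continuous f -> continuous g ->
  L (fun x => f x - g x) = L f - L g.
Proof.
move=> cf cg; rewrite -mulN1r -stateZ// -stateD//.
  by congr L; apply/funext => x; rewrite mulN1r.
by apply: continuousMr => //; exact: continuous_cstr.
Qed.

Lemma le_state (f g : T -> R) : continuous f -> continuous g ->
  (forall x, f x <= g x) -> L f <= L g.
Proof.
have [_ pos _] := stateL => cf cg fg; rewrite -subr_ge0 -stateB//.
by apply: pos => [|x]; [exact: continuousBr|rewrite subr_ge0].
Qed.

(* Daniell-style outer measure: sets are covered by increasing sequences of
   continuous functions rather than by open sets, so that countable
   subadditivity and the measurability of open sets only need [L] on products
   and finite sums of such functions. *)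
Definition riesz_cover (A : set T) (M : R) := exists F : nat -> T -> R,
  [/\ forall n, continuous (F n), forall n x, 0 <= F n x,
      forall x, {homo F ^~ x : m n / (m <= n)%N >-> m <= n},
      forall x, A x -> exists n, 1 <= F n x
    & forall n, L (F n) <= M].

(** A real infimum suffices: the constant function [1] covers every set, so all values are
    finite. *)
Definition riesz_outer (A : set T) : \bar R :=
  (inf [set M | riesz_cover A M])%:E.

Lemma riesz_cover_ge0 A M : riesz_cover A M -> 0 <= M.
Proof.
have [_ pos _] := stateL => -[F [cF F0 _ _ FM]].
by apply: le_trans (FM 0%N); exact: pos.
Qed.

Lemma riesz_cover1 A : riesz_cover A 1.
Proof.
exists (fun _ _ => 1); split=> //.
- by move=> n; exact: continuous_cstr.
- by move=> x m n _.
- by move=> x _; exists 0%N.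
- by move=> n; rewrite state_cst.
Qed.

Lemma riesz_cover_has_inf A : has_inf [set M | riesz_cover A M].
Proof.
split; first by exists 1; exact: riesz_cover1.
by exists 0 => M; exact: riesz_cover_ge0.
Qed.

Lemma riesz_outer_le A M : riesz_cover A M -> (riesz_outer A <= M%:E)%E.
Proof.
move=> AM; rewrite lee_fin; apply: ge_inf => //.
by have [] := riesz_cover_has_inf A.
Qed.

Lemma riesz_outer_adherent A e : 0 < e ->
  exists2 M, riesz_cover A M & (M%:E <= riesz_outer A + e%:E)%E.
Proof.
move=> e0; have [M AM Me] := inf_adherent e0 (riesz_cover_has_inf A).
by exists M => //; rewrite /riesz_outer -EFinD lee_fin ltW.
Qed.

Lemma riesz_outer_ge A M : (forall N, riesz_cover A N -> M <= N) ->
  (M%:E <= riesz_outer A)%E.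
Proof.
move=> AM; rewrite lee_fin; apply: lb_le_inf => //.
by have [] := riesz_cover_has_inf A.
Qed.

Lemma riesz_outer_ge0 A : (0 <= riesz_outer A)%E.
Proof. by apply: riesz_outer_ge => N; exact: riesz_cover_ge0. Qed.

Lemma riesz_outer0 : riesz_outer set0 = 0%E.
Proof.
apply/eqP; rewrite eq_le riesz_outer_ge0 andbT; apply: riesz_outer_le.
exists (fun _ _ => 0); split=> //.
- by move=> n; exact: continuous_cstr.
- by move=> x m n _.
- by move=> n; rewrite state0.
Qed.

Lemma le_riesz_outer : {homo riesz_outer : A B / A `<=` B >-> (A <= B)%E}.
Proof.
move=> A B AB; apply: riesz_outer_ge => M [F [cF F0 ndF FB FM]].
rewrite -lee_fin; apply: riesz_outer_le; exists F; split=> //.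
by move=> x /AB; exact: FB.
Qed.

(** Choose for each [A n] a cover that is optimal up to [e / 2 ^ n.+1]. If the bounds [M n] have a
    finite sum [s], the covers combine into one of mass [s]; otherwise there is nothing to prove. *)
Lemma riesz_outer_sigma_subadditive : sigma_subadditive riesz_outer.
Proof.
move=> A; apply/lee_addgt0Pr => e e0.
rewrite (le_trans _ (epsilon_trick _ _ (ltW e0)))//; last first.
  by move=> n; exact: riesz_outer_ge0.
have /choice[M AM] n : exists M, riesz_cover (A n) M /\
    (M%:E <= riesz_outer (A n) + (e / (2 ^ n.+1)%:R)%:E)%E.
  have en0 : 0 < e / (2 ^ n.+1)%:R by rewrite divr_gt0// ltr0n expn_gt0.
  by have [M ? ?] := riesz_outer_adherent (A n) en0; exists M.
have /choice[F AF] n := (AM n).1.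
have M0 n : (0 <= (M n)%:E)%E by rewrite lee_fin; exact: riesz_cover_ge0 (AM n).1.
apply: (@le_trans _ _ (\sum_(i <oo) (M i)%:E)%E); last first.
  by apply: lee_nneseries => // n _; exact: (AM n).2.
have := nneseries_ge0 (fun n (_ : (0 <= n)%N) (_ : xpredT n) => M0 n).
move sE : (\sum_(i <oo) (M i)%:E)%E => [s| |]// _; last by rewrite leey.
apply: riesz_outer_le.
(* Diagonal combination: stage [n] adds the first [n] covers, each taken at its own stage [n]. It
   stays a finite sum, so finite additivity of [L] is enough. *)
pose G n x := \sum_(i < n) F i n x.
have cG n m : continuous (fun x => \sum_(i < m) F i n x).
  elim: m => [|m IH]; first by under eq_fun do rewrite big_ord0; exact: continuous_cstr.
  under eq_fun do rewrite big_ord_recr /=.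
  by apply: continuousDr => //; have [+ _ _ _ _] := AF m; exact.
have F0 i n x : 0 <= F i n x by have [_ + _ _ _] := AF i; exact.
exists G; split=> //.
- by move=> n; exact: cG.
- by move=> n x; apply: sumr_ge0.
- move=> x; apply/nondecreasing_seqP => n; rewrite /G big_ord_recr /=.
  rewrite -[leLHS]addr0 lerD//; apply: ler_sum => i _.
  by have [_ _ + _ _] := AF i; apply.
- move=> x [i _ Aix]; have [_ _ ndF /(_ x Aix)[n Fn] _] := AF i.
  exists (maxn i.+1 n); rewrite /G (le_trans Fn)//.
  rewrite (bigD1 (Ordinal (leq_maxl i.+1 n)))//= -[leLHS]addr0 lerD//.
    by apply: ndF; exact: leq_maxr.
  exact: sumr_ge0.
- move=> n; rewrite -lee_fin -sE.
  apply: (@le_trans _ _ (\sum_(0 <= i < n) (M i)%:E)%E); last first.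
    exact: nneseries_lim_ge.
  rewrite sumEFin lee_fin big_mkord /G.
  have : forall m, L (fun x => \sum_(i < m) F i n x) <= \sum_(i < m) M i.
    elim=> [|m IH].
      by under eq_fun do rewrite big_ord0; rewrite big_ord0 state0.
    under eq_fun do rewrite big_ord_recr /=.
    have [cF _ _ _ FM] := AF m.
    by rewrite (stateD (cG n m) (cF n)) big_ord_recr lerD.
  exact.
Qed.

HB.instance Definition _ := isOuterMeasure.Build R T riesz_outer
  riesz_outer0 riesz_outer_ge0 le_riesz_outer riesz_outer_sigma_subadditive.

(** A near-optimal cover [F] of [X] is split with the cutoffs [phi] of [U]: [F n * phi n] covers [X]
    inside [U], and [F n * (1 - phi k)], with [k] fixed, covers [X] outside [U], where [phi k]
    vanishes. *)
Lemma open_riesz_caratheodory U : open U ->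
  riesz_outer.-caratheodory U.
Proof.
move=> oU; apply: le_caratheodory_measurable => X.
have [phi [cphi phi01 ndphi phiC phiU]] := open_cutoff oU.
apply/lee_addgt0Pr => e e0.
have e20 : 0 < e / 2 by rewrite divr_gt0.
have [M [F [cF F0 ndF FX FM]] Me] := riesz_outer_adherent X e20.
have phi0 n x : 0 <= phi n x by have /andP[] := phi01 n x.
have phi1 n x : phi n x <= 1 by have /andP[] := phi01 n x.
have cFphi n k : continuous (fun x => F n x * phi k x) by exact: continuousMr.
have LFphi n k : L (fun x => F n x * phi k x) <= M.
  by apply: le_trans (FM n); apply: le_state => // x; rewrite ler_piMr.
pose a := sup (range (fun n => L (fun x => F n x * phi n x))).
have has_a : has_sup (range (fun n => L (fun x => F n x * phi n x))).
  by split; [exists (L (fun x => F 0%N x * phi 0%N x)), 0%N|exists M => _ [n _ <-]].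
have coverU : riesz_cover (X `&` U) a.
  exists (fun n x => F n x * phi n x); split=> //.
  - by move=> n x; rewrite mulr_ge0.
  - by move=> x m n mn; rewrite ler_pM//; [exact: ndF|exact: ndphi].
  - move=> x [Xx Ux]; have [n Fn] := FX x Xx; have [k phik] := phiU x Ux.
    exists (maxn n k).
    have -> : phi (maxn n k) x = 1.
      by apply/eqP; rewrite eq_le phi1 -phik; apply: ndphi; exact: leq_maxr.
    by rewrite mulr1 (le_trans Fn)//; apply: ndF; exact: leq_maxl.
  - by move=> n; apply: ub_le_sup; [exact: has_a.2|exists n].
(* This [k] makes the two masses add up to at most [M + e / 2]: for [n] beyond [k],
   [L (F n * (1 - phi k))] is at most [M - L (F n * phi k)], hence at most [M - L (F k * phi k)].
   Smaller [n] follow by monotonicity. *)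
have [_ [k _ <-] ak] := sup_adherent e20 has_a.
have coverUC : riesz_cover (X `&` ~` U) (M - (a - e / 2)).
  have cFphi' n : continuous (fun x => F n x * (1 - phi k x)).
    apply: continuousMr => //; apply: continuousBr => //; exact: continuous_cstr.
  have LE n : L (fun x => F n x * (1 - phi k x)) <= M - L (fun x => F n x * phi k x).
    rewrite lerBrDr -stateD//; apply: le_trans (FM n).
    apply: le_state => //; first exact: continuousDr.
    by move=> x; rewrite -mulrDr subrK mulr1.
  have nd x : {homo (fun n => F n x * (1 - phi k x)) : m n / (m <= n)%N >-> m <= n}.
    by move=> m n mn; rewrite ler_wpM2r ?subr_ge0//; exact: ndF.
  exists (fun n x => F n x * (1 - phi k x)); split=> //.
  - by move=> n x; rewrite mulr_ge0// subr_ge0.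
  - move=> x [Xx nUx]; have [n Fn] := FX x Xx.
    by exists n; rewrite phiC// subr0 mulr1.
  - move=> n; apply: (@le_trans _ _ (L (fun x => F (maxn n k) x * (1 - phi k x)))).
      by apply: le_state => // x; apply: nd; exact: leq_maxl.
    apply: le_trans (LE _) _; rewrite lerB// (le_trans (ltW ak))//.
    apply: le_state => // x; rewrite ler_wpM2r//.
    by apply: ndF; exact: leq_maxr.
apply: (le_trans (leeD (riesz_outer_le coverU) (riesz_outer_le coverUC))).
rewrite -EFinD opprB addrC -addrA subrK.
by rewrite EFinD [in leRHS](splitr e) EFinD addeA leeD2r.
Qed.

(** The lower bound is Dini's argument: [1 - e < F n x] is open in [x] and persists as [n] grows, so
    by compactness one [n] serves all [x], and [1 - e = L (1 - e) <= L (F n) <= M]. *)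
Lemma riesz_outerT : riesz_outer setT = 1%E.
Proof.
apply/eqP; rewrite eq_le; apply/andP; split.
  by apply: riesz_outer_le; exact: riesz_cover1.
apply: riesz_outer_ge => M [F [cF F0 ndF FT FM]].
apply/ler_addgt0Pr => e e0.
have [n nF] : exists n, forall x, 1 - e < F n x.
  have /compact_near_coveringP/(_ _ \oo (fun n x => 1 - e < F n x)) := compactT.
  case=> [x _|n _ /(_ n (leqnn n)) nF]; last by exists n => x; exact: nF.
  have [n Fn] := FT x I.
  have eFn : 1 - e < F n x by rewrite (lt_le_trans _ Fn)// ltrBlDr ltrDl.
  exists ([set y | 1 - e < F n y], [set m | (n <= m)%N]).
    by split; [exact: cvgr_gt (cF n x) _ eFn|exists n].
  by move=> [y m] /= [yFn nm]; rewrite (lt_le_trans yFn)//; exact: ndF.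
rewrite -lerBlDr -(state_cst (1 - e)) (le_trans _ (FM n))//.
by apply: le_state => // [|x]; [exact: continuous_cstr|exact/ltW].
Qed.

(** A copy on [borel T], carrying the measure structure on Borel sets beside the outer measure
    structure of [riesz_outer]. *)
Definition riesz_measure : set (borel T) -> \bar R := riesz_outer.

Lemma borel_riesz_caratheodory :
  @measurable _ (borel T) `<=` riesz_outer.-caratheodory.
Proof.
apply: smallest_sub => [|U]; last exact: open_riesz_caratheodory.
split.
- exact: caratheodory_measurable_set0.
- by move=> A; rewrite setTD; exact: caratheodory_measurable_setC.
- by move=> A; exact: caratheodory_measurable_bigcup.
Qed.

Lemma riesz_measure_semi_sigma_additive : semi_sigma_additive riesz_measure.
Proof.
move=> A mA tA mbA.
apply: (caratheodory_measure_sigma_additive (mu := riesz_outer)) => //.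
  by move=> i; exact: borel_riesz_caratheodory.
exact: borel_riesz_caratheodory.
Qed.

HB.instance Definition _ := isMeasure.Build _ (borel T) R riesz_measure
  riesz_outer0 riesz_outer_ge0 riesz_measure_semi_sigma_additive.

HB.instance Definition _ := Measure_isProbability.Build _ (borel T) R
  riesz_measure riesz_outerT.

(* Cutting [f] at height [d] and inducting on the number of layers: the upper
   part [max (f - d) 0] lives on a set covered by [min f d / d]. *)
Lemma Rintegral_le_state_layer (d : R) (m : nat) (f : T -> R) : 0 < d ->
  continuous f -> (forall x, 0 <= f x <= m%:R * d) ->
  \int[riesz_measure]_x f x
    <= L f + d * fine (riesz_outer [set x | 0 < f x]).
Proof.
move=> d0; elim: m f => [|m IH] f cf fm.
  have -> : f = fun=> 0.
    by apply/funext => x; apply/eqP; rewrite eq_le; move: (fm x); rewrite mul0r andbC.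
  rewrite state0 add0r Rintegral_probability_cst.
  by rewrite mulr_ge0// ?fine_ge0 ?riesz_outer_ge0 ?ltW.
pose f0 : T -> R := f \min (fun=> d).
pose g : T -> R := (fun x => f x - d) \max (fun=> 0).
have cf0 : continuous f0.
  by move=> x; apply: continuous_min; [exact: cf|exact: cvg_cst].
have cg : continuous g.
  move=> x; apply: continuous_max; last exact: cvg_cst.
  exact: (continuousBr cf (@continuous_cstr R T d)).
have fE x : f x = f0 x + g x.
  by rewrite /f0 /g /=; case: (leP (f x) d) => ?; case: (leP (f x - d) 0) => ?; lra.
have Lf : L f = L f0 + L g by rewrite -stateD//; congr L; exact/funext.
have f0_le : \int[riesz_measure]_x f0 x <= d * fine (riesz_outer [set x | 0 < f x]).
  have mA : measurable ([set x | 0 < f x] : set (borel T)).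
    apply: sub_sigma_algebra; rewrite (_ : mkset _ = f @^-1` [set y | 0 < y])//.
    by apply: open_comp => //; exact: open_gt.
  rewrite (_ : fine _ = \int[riesz_measure]_x (\1_[set x | 0 < f x] x : R)); last first.
    by rewrite /Rintegral integral_indic// setIT.
  rewrite -RintegralZl//; last exact: integrable_indic.
  apply: le_Rintegral => //.
  - exact: continuous_integrable.
  - exact: (integrableZl measurableT d (integrable_indic riesz_measure mA)).
  - move=> x _; rewrite indicE; have [fx|fx] := ltP 0 (f x).
      by rewrite mem_set//= mulr1 /f0 /= ge_min lexx orbT.
    by rewrite memNset/= ?mulr0 /f0 /= ?ge_min ?fx//= ltNge fx.
(* Where [g > 0] one has [f > d], so [f0 = d] there and the constant sequence [d^-1 * f0] is a
   cover. *)
have g_le : d * fine (riesz_outer [set x | 0 < g x]) <= L f0.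
  rewrite mulrC -ler_pdivlMr// -lee_fin fineK//.
  apply: riesz_outer_le; exists (fun _ x => d^-1 * f0 x); split=> //.
  - by move=> _; apply: continuousMr => //; exact: continuous_cstr.
  - move=> _ x; rewrite mulr_ge0 ?invr_ge0 ?(ltW d0)// /f0 /= le_min (ltW d0) andbT.
    by have /andP[] := fm x.
  - by move=> x m' n _.
  - move=> x /= gx; exists 0%N; rewrite /f0 /= min_r ?mulVf ?gt_eqF//.
    by move: gx; rewrite /g /= lt_max ltxx orbF subr_gt0 => /ltW.
  - by move=> _; rewrite stateZ// mulrC.
have -> : \int[riesz_measure]_x f x =
    \int[riesz_measure]_x f0 x + \int[riesz_measure]_x g x.
  under eq_Rintegral do rewrite fE.
  by apply: RintegralD => //; exact: continuous_integrable.
have gm x : 0 <= g x <= m%:R * d.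
  have /andP[fx0] := fm x; rewrite -natr1 mulrDl mul1r /g /=.
  rewrite le_max lexx orbT /= ge_max lerBlDr => -> /=.
  by rewrite mulr_ge0// ltW.
(* The error term of the induction hypothesis for [g] is absorbed by [L f0]; only the error of the
   bottom layer survives, so errors do not accumulate with [m]. *)
rewrite Lf addrC lerD//.
by apply: le_trans (IH g cg gm) _; rewrite addrC lerD2r.
Qed.

Lemma Rintegral_le_state (f : T -> R) : continuous f -> (forall x, 0 <= f x) ->
  \int[riesz_measure]_x f x <= L f.
Proof.
move=> cf f0; apply/ler_addgt0Pr => e e0.
have [M M0 fM] := compact_continuous_bounded compactT cf.
(* Layers of height [e], enough of them to exceed the bound [M]; the remaining error is at most [e]
   because the total mass is [1]. *)
have := @Rintegral_le_state_layer e (Num.truncn (M / e)).+1 f e0 cf.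
move=> /(_ _)/le_trans; apply.
  move=> x; rewrite f0 (le_trans (ler_norm _))// (le_trans (fM x))//.
  by rewrite -ler_pdivrMr// ltW// -truncn_le_nat.
rewrite lerD2l -[leRHS]mulr1 ler_pM2l// -lee_fin fineK//.
by rewrite -riesz_outerT; exact: le_riesz_outer.
Qed.

(** Adding a constant extends the inequality between integral and [L] from nonnegative to all
    continuous functions; applying it to [- f] then gives equality. *)
Lemma riesz_markov :
  exists mu : probability (borel T) R,
    forall f : T -> R, continuous f -> \int[mu]_x f x = L f.
Proof.
exists riesz_measure.
have le f : continuous f -> \int[riesz_measure]_x f x <= L f.
  move=> cf; have [M M0 fM] := compact_continuous_bounded compactT cf.
  have cfM : continuous (fun x => f x + M).
    by apply: continuousDr => //; exact: continuous_cstr.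
  have := Rintegral_le_state cfM.
  rewrite stateD//; last exact: continuous_cstr.
  rewrite state_cst RintegralD//; last 2 first.
  - exact: continuous_integrable.
  - apply: continuous_integrable => //; exact: continuous_cstr.
  rewrite Rintegral_probability_cst lerD2r; apply => x.
  by have := fM x; rewrite ler_norml => /andP[+ _]; rewrite -subr_ge0 opprK.
move=> f cf; apply/eqP; rewrite eq_le le//= -lerN2.
have cNf : continuous (fun x => -1 * f x).
  by apply: continuousMr => //; exact: continuous_cstr.
have := le _ cNf; rewrite stateZ// RintegralZl//; last exact: continuous_integrable.
by rewrite !mulN1r.
Qed.

End RieszMarkov.

(** * Limits of bounded functions along ultrafilters *)

Section UltraLimits.
Context {R : realType}.

Lemma ultrafilter_fmap (S T : Type) (f : S -> T) (F : set_system S) :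
  UltraFilter F -> UltraFilter (f @ F).
Proof.
move=> UF; split; first exact: fmap_proper_filter.
move=> G PG FG; apply/seteqP; split=> [B GB|]; last exact: FG.
have [//|FnB] := in_ultra_setVsetC (f @^-1` B) UF.
have GnB : G (~` B) by exact: FG.
by case: (filter_ex (filterI GB GnB)) => x [].
Qed.

Lemma bounded_ultra_cvg (S : Type) (F : set_system S) (f : S -> R) (M : R) :
  UltraFilter F -> (forall x, `|f x| <= M) -> cvg (f @ F).
Proof.
move=> UF fM; have := @segment_compact R (- M) M.
rewrite compact_ultra => /(_ (f @ F) (ultrafilter_fmap f UF)) [|l [_ fl]].
  by apply: (@filterE _ F) => x; rewrite /= in_itv /= -ler_norml fM.
by apply/cvg_ex; exists l.
Qed.

End UltraLimits.

(** * Continuity of integrals depending on a parameter *)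

Section ParametricIntegrals.
Context {R : realType}.

(** Compactness of [X] makes the continuity of [f (x, z)] at [z0] uniform in [x]; the uniform bound
    then passes through the probability [alpha]. *)
Lemma parametric_integral_continuous (X : ptopologicalType) (Z : topologicalType)
    (alpha : probability (borel X) R) (f : X * Z -> R) :
  compact [set: X] -> continuous f ->
  continuous (fun z => \int[alpha]_x f (x, z)).
Proof.
move=> cX cf z0.
have cfz z : continuous (fun x => f (x, z)).
  move=> x; apply: (continuous_comp (f := fun x => (x, z))); last exact: cf.
  by apply: cvg_pair => //; exact: cvg_cst.
apply/cvgrPdist_le => e e0.
have e20 : 0 < e / 2 by rewrite divr_gt0.
have /compact_near_coveringP ncX := cX.
have : \forall z \near z0, [set: X] `<=` (fun x => `|f (x, z0) - f (x, z)| <= e).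
  apply: ncX => x _.
  have /cvgrPdist_le/(_ _ e20)[[U V] /= [xU zV] UV] := cf (x, z0).
  exists (U, V); first by split.
  move=> [x' z] /= [Ux' Vz].
  have h1 := UV (x', z0) (conj Ux' (nbhs_singleton zV)).
  have h2 := UV (x', z) (conj Ux' Vz).
  rewrite -(subrKA (f (x, z0))) (le_trans (ler_normD _ _))// distrC.
  by rewrite [leRHS]splitr lerD.
apply: filterS => z fz.
have i1 := continuous_integrable alpha cX (cfz z0).
have i2 := continuous_integrable alpha cX (cfz z).
rewrite -RintegralB//.
rewrite (le_trans (le_normr_Rintegral _ _))//.
  exact: (integrableB measurableT i1 i2).
rewrite -[leRHS](Rintegral_probability_cst alpha); apply: le_Rintegral => //.
- exact: (integrable_norm (integrableB measurableT i1 i2)).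
- exact: finite_measure_integrable_cst.
Qed.

End ParametricIntegrals.

(** * Continuity of Lipschitz potentials, of the iterated function system and of the transfer
    operator *)

Section Contractive.
Context {R : realType} {X Z : pmetricType R}.
Implicit Types (tau : X -> Z -> Z) (c b : X * Z -> R).

(** Links bounds in the sum distance to the product topology; the general target [Y] serves both
    real potentials and [tau]. *)
Lemma mdist_sum_continuous (Y : metricType R) (f : X * Z -> Y) (K : R) :
  (forall x1 x2 z1 z2, mdist (f (x1, z1)) (f (x2, z2))
     <= K * (mdist x1 x2 + mdist z1 z2)) -> continuous f.
Proof.
move=> fK [x z]; apply/metricType_numDomainType.cvgrPdist_lt => e e0.
(* The factor [|K| + 1] is positive whatever the sign of [K], and two coordinates at distance below
   [d] contribute less than [e] in all. *)
pose d := e / (2 * (`|K| + 1)).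
have K0 : 0 < `|K| + 1 by rewrite ltr_wpDl.
have d0 : 0 < d by rewrite divr_gt0// mulr_gt0.
exists (ball x d, ball z d); first by split; exact: nbhsx_ballx.
move=> [x' z'] /=; rewrite !ballEmdist /= => -[xx' zz'].
rewrite (le_lt_trans (fK _ _ _ _))//.
apply: (@le_lt_trans _ _ ((`|K| + 1) * (mdist x x' + mdist z z'))).
  rewrite ler_wpM2r ?addr_ge0 ?mdist_ge0//.
  by rewrite (le_trans (ler_norm K))// lerDl.
have -> : e = (`|K| + 1) * (d + d).
  by rewrite /d; field; rewrite gt_eqF.
by rewrite ltr_pM2l// ltrD.
Qed.

Lemma sum_lipschitz_continuous c : sum_lipschitz c -> continuous c.
Proof.
move=> [K cK]; apply: (@mdist_sum_continuous R^o c K) => x1 x2 z1 z2.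
by rewrite /mdist /= distrC; exact: cK.
Qed.

Lemma contractive_continuous tau : uniformly_contractive tau ->
  continuous (fun w : X * Z => tau w.1 w.2).
Proof. by move=> [g _ tg]; exact: (@mdist_sum_continuous Z _ g). Qed.

Lemma continuous_comp_ifs tau (g : Z -> R) : uniformly_contractive tau ->
  continuous g -> continuous (fun w : X * Z => g (tau w.1 w.2)).
Proof.
move=> /contractive_continuous ct cg w.
by apply: (continuous_comp (f := fun w : X * Z => tau w.1 w.2)); [exact: ct|exact: cg].
Qed.

Lemma continuous_comp_snd (g : Z -> R) :
  continuous g -> continuous (fun w : X * Z => g w.2).
Proof. by move=> cg w; apply: continuous_comp; [exact: cvg_snd|exact: cg]. Qed.

Lemma continuous_expR_comp (S : topologicalType) (f : S -> R) :
  continuous f -> continuous (fun w => expR (f w)).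
Proof.
by move=> cf w; apply: continuous_comp; [exact: cf|exact: continuous_expR].
Qed.

Lemma continuous_ln_comp (S : topologicalType) (f : S -> R) :
  continuous f -> (forall w, 0 < f w) -> continuous (fun w => ln (f w)).
Proof.
by move=> cf f0 w; apply: continuous_comp; [exact: cf|exact: continuous_ln].
Qed.

Lemma continuous_pair1 (f : X * Z -> R) z :
  continuous f -> continuous (fun x => f (x, z)).
Proof.
move=> cf x; apply: (continuous_comp (f := fun x => (x, z))); last exact: cf.
by apply: cvg_pair => //; exact: cvg_cst.
Qed.

Lemma normalized_Rintegral_weight tau (alpha : probability (borel X) R) b z :
  normalized tau alpha b -> \int[alpha]_x expR (b (x, z)) = 1.
Proof.
move=> [_ bz]; rewrite -[RHS](bz z).
by apply: eq_Rintegral => x _; rewrite mulr1.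
Qed.

Lemma transfer_continuous tau (alpha : probability (borel X) R) b (u : Z -> R) :
  compact [set: X] -> uniformly_contractive tau -> continuous b -> continuous u ->
  continuous (transfer tau alpha b u).
Proof.
move=> cX ct cb cu.
apply: (@parametric_integral_continuous R X Z alpha
  (fun w => expR (b w) * u (tau w.1 w.2)) cX).
exact: (continuousMr (continuous_expR_comp cb) (continuous_comp_ifs ct cu)).
Qed.

End Contractive.

HB.instance Definition _ (R : numDomainType) (X Z : pseudoPMetricType R) :=
  Pointed.on (X * Z)%type.

(** * Invariant states of a normalized transfer operator, associated holonomic probabilities and
    their entropy *)

Section InvariantState.
Context {R : realType} {X Z : pmetricType R}.
Hypotheses (compactX : compact [set: X]) (compactZ : compact [set: Z]).
Variables (tau : X -> Z -> Z) (alpha : probability (borel X) R) (b : X * Z -> R).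
Hypotheses (tau_contractive : uniformly_contractive tau)
  (norm_b : normalized tau alpha b).

Let cb : continuous b.
Proof. by have [lb _] := norm_b; exact: sum_lipschitz_continuous. Qed.

Lemma continuous_weight (g : X * Z -> R) :
  continuous g -> continuous (fun w => expR (b w) * g w).
Proof.
by move=> cg w; apply: cvgM; [exact: (continuous_expR_comp cb)|exact: cg].
Qed.

Lemma integrable_weight (g : X * Z -> R) z : continuous g ->
  alpha.-integrable [set: borel X] (EFin \o (fun x => expR (b (x, z)) * g (x, z))).
Proof.
move=> cg; apply: (continuous_integrable alpha compactX).
exact: (continuous_pair1 (z := z) (continuous_weight cg)).
Qed.

Lemma fiber_integral_cst (a : R) z : \int[alpha]_x (expR (b (x, z)) * a) = a.
Proof.
rewrite RintegralZr// ?(normalized_Rintegral_weight z norm_b) ?mul1r//.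
by apply: (continuous_integrable alpha compactX);
   exact: (continuous_pair1 (z := z) (continuous_expR_comp cb)).
Qed.

(** Stated on [X * Z] to serve both the operator [P], with integrands [u (tau x z)], and the
    functional that defines the associated probability. *)
Lemma fiber_integral_linear (a : R) (f g : X * Z -> R) z :
  continuous f -> continuous g ->
  \int[alpha]_x (expR (b (x, z)) * (a * f (x, z) + g (x, z))) =
  a * \int[alpha]_x (expR (b (x, z)) * f (x, z)) +
  \int[alpha]_x (expR (b (x, z)) * g (x, z)).
Proof.
move=> cf cg; rewrite -RintegralZl//; last exact: integrable_weight.
rewrite -RintegralD//.
- by apply: eq_Rintegral => x _; rewrite mulrDr mulrCA.
- exact: (integrableZl measurableT a (integrable_weight z cf)).
- exact: integrable_weight.
Qed.

Lemma fiber_integral_ge0 (g : X * Z -> R) z : (forall w, 0 <= g w) ->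
  0 <= \int[alpha]_x (expR (b (x, z)) * g (x, z)).
Proof. by move=> g0; apply: Rintegral_ge0 => x _; rewrite mulr_ge0 ?expR_ge0. Qed.

Lemma fiber_integral_continuous (g : X * Z -> R) : continuous g ->
  continuous (fun z => \int[alpha]_x (expR (b (x, z)) * g (x, z))).
Proof.
move=> cg; apply: (@parametric_integral_continuous R X Z alpha
  (fun w => expR (b w) * g w)) => //; exact: continuous_weight.
Qed.

Let P := transfer tau alpha b.

Let cP (u : Z -> R) : continuous u -> continuous (P u).
Proof. by move=> cu; exact: transfer_continuous. Qed.

Let P_linear (a : R) (u v : Z -> R) : continuous u -> continuous v ->
  P (fun z => a * u z + v z) = (fun z => a * P u z + P v z).
Proof.
move=> cu cv; apply/funext => z.
exact: (fiber_integral_linear a z (continuous_comp_ifs tau_contractive cu)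
  (continuous_comp_ifs tau_contractive cv)).
Qed.

Let P_ge0 (u : Z -> R) : (forall z, 0 <= u z) -> forall z, 0 <= P u z.
Proof.
by move=> u0 z; exact: (@fiber_integral_ge0 (fun w => u (tau w.1 w.2))).
Qed.

Let P_cst (a : R) : P (fun=> a) = (fun=> a).
Proof. by apply/funext => z; exact: fiber_integral_cst. Qed.

(** Positivity of [P] on [M + u] and [M - u]; the factors [1] and [-1] only match the shape of
    [P_linear]. *)
Let P_bound (u : Z -> R) M : continuous u -> (forall z, `|u z| <= M) ->
  forall z, `|P u z| <= M.
Proof.
move=> cu uM z; rewrite ler_norml; apply/andP; split.
  have : 0 <= P (fun z => 1 * u z + M) z.
    apply: P_ge0 => y; rewrite mul1r -lerBlDr sub0r.
    by have := uM y; rewrite ler_norml => /andP[].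
  rewrite P_linear//; last exact: continuous_cstr.
  by rewrite P_cst mul1r -lerBlDr sub0r.
have : 0 <= P (fun z => -1 * u z + M) z.
  apply: P_ge0 => y; rewrite mulN1r addrC subr_ge0.
  by have := uM y; rewrite ler_norml => /andP[].
rewrite P_linear//; last exact: continuous_cstr.
by rewrite P_cst mulN1r addrC subr_ge0.
Qed.

(** Integral of [u] against the average of the first [n.+1] iterates of the dual operator on the
    Dirac mass at [point]. *)
Let cesaro n (u : Z -> R) : R :=
  n.+1%:R^-1 * \sum_(k < n.+1) iter k P u point.

Let iter_continuous k (u : Z -> R) : continuous u -> continuous (iter k P u).
Proof. by move=> cu; elim: k => //= k; exact: cP. Qed.

Let iter_bound k (u : Z -> R) M : continuous u -> (forall z, `|u z| <= M) ->
  forall z, `|iter k P u z| <= M.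
Proof.
by move=> cu uM; elim: k => //= k IH; apply: P_bound => //; exact: iter_continuous.
Qed.

Let iter_linear k (a : R) (u v : Z -> R) : continuous u -> continuous v ->
  iter k P (fun z => a * u z + v z) = (fun z => a * iter k P u z + iter k P v z).
Proof.
by move=> cu cv; elim: k => //= k ->; rewrite P_linear//; exact: iter_continuous.
Qed.

Let cesaro_bound n (u : Z -> R) M : continuous u -> (forall z, `|u z| <= M) ->
  `|cesaro n u| <= M.
Proof.
move=> cu uM; rewrite /cesaro normrM ger0_norm ?invr_ge0//.
rewrite ler_pdivrMl ?ltr0n// (le_trans (ler_norm_sum _ _ _))//.
rewrite (@le_trans _ _ (\sum_(k < n.+1) M))//.
  by apply: ler_sum => k _; exact: iter_bound.
by rewrite sumr_const card_ord mulr_natl.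
Qed.

Let cesaro_linear n (a : R) (u v : Z -> R) : continuous u -> continuous v ->
  cesaro n (fun z => a * u z + v z) = a * cesaro n u + cesaro n v.
Proof.
move=> cu cv; rewrite /cesaro mulrCA -mulrDr; congr (_ * _).
rewrite mulr_sumr -big_split /=; apply: eq_bigr => k _.
by rewrite iter_linear.
Qed.

(** The sum telescopes to two boundary terms, which are bounded, so the difference vanishes as [n]
    grows. *)
Let cesaro_shift n (u : Z -> R) :
  cesaro n (P u) - cesaro n u = n.+1%:R^-1 * (iter n.+1 P u point - u point).
Proof.
rewrite /cesaro -mulrBr; congr (_ * _).
rewrite (eq_bigr (fun k : 'I_n.+1 => iter k.+1 P u point)); last first.
  by move=> k _; rewrite iterSr.
rewrite -sumrB.
rewrite -(big_mkord xpredT (fun k => iter k.+1 P u point - iter k P u point)).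
by rewrite telescope_sumr.
Qed.

(* Krylov-Bogoliubov: an ultrafilter limit of Cesaro averages is shift
   invariant, with no convergence of the iterates needed. *)
Lemma invariant_state : exists L : (Z -> R) -> R, state L /\
  forall u : Z -> R, continuous u -> L (transfer tau alpha b u) = L u.
Proof.
(* [U] refines [\oo]: bounded sequences converge along it, and ordinary limits are kept. *)
have [U [UU oU]] := ultraFilterLemma (@eventually_filter).
pose L u := lim (cesaro n u @[n --> U]).
have cvgL (u : Z -> R) : continuous u -> cesaro n u @[n --> U] --> L u.
  move=> cu; have [M _ uM] := compact_continuous_bounded compactZ cu.
  by apply: (bounded_ultra_cvg (M := M)) => n; exact: cesaro_bound.
exists L; split; first split.
- move=> a u v cu cv; apply/cvg_lim => //.
  rewrite (_ : (fun n => _) = (fun n => a * cesaro n u + cesaro n v)); last first.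
    by apply/funext => n; exact: cesaro_linear.
  by apply: cvgD; [apply: cvgMl_tmp; exact: cvgL|exact: cvgL].
- move=> u cu u0; apply: cvgr_to_ge (cvgL u cu) _; apply: nearW => n.
  rewrite mulr_ge0 ?invr_ge0// sumr_ge0// => k _.
  by elim: (val k) point => // m IH z /=; exact: P_ge0.
- apply/cvg_lim => //; apply: cvg_near_cst; apply: nearW => n.
  rewrite /cesaro (eq_bigr (fun=> 1)); last first.
    move=> k _; have -> // : iter k P (fun=> 1) = fun=> 1.
    by elim: (val k) => //= m ->; exact: P_cst.
  by rewrite sumr_const card_ord mulVf.
- move=> u cu; apply/eqP; rewrite -subr_eq0; apply/eqP.
  have [M M0 uM] := compact_continuous_bounded compactZ cu.
  have h1 : (cesaro n (P u) - cesaro n u) @[n --> U] --> L (P u) - L u.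
    by apply: cvgB; apply: cvgL => //; exact: cP.
  have h2 : (cesaro n (P u) - cesaro n u) @[n --> U] --> (0 : R).
    suff h : (cesaro n (P u) - cesaro n u) @[n --> \oo] --> (0 : R).
      by move=> A /h; exact: oU.
    apply/cvgrPdist_le => e e0.
    have d0 : 0 < e / (M + M) by rewrite divr_gt0 ?addr_gt0.
    have := near_infty_natSinv_lt (PosNum d0).
    apply: filterS => n /= nd; rewrite sub0r normrN cesaro_shift normrM.
    rewrite ger0_norm ?invr_ge0//.
    rewrite -[leRHS](@divfK _ (M + M)) ?gt_eqF ?addr_gt0//.
    rewrite ler_pM ?invr_ge0// ?(ltW nd)// (le_trans (ler_normB _ _))//.
    by rewrite lerD//; exact: (iter_bound n.+1).
  exact: (cvg_unique _ h1 h2).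
Qed.

Let compactXZ : compact [set: X * Z].
Proof. by rewrite -setXTT; exact: compact_setX. Qed.

(** The first use of Riesz-Markov turns the invariant state into [rho]. The iterated integral that
    [p] must reproduce is itself a state [G] on [X * Z], and the second use represents it. *)
Lemma normalized_holonomic_associated :
  exists p : probability (borel (X * Z)) R, holonomic_associated tau alpha b p.
Proof.
have [L [stateL invL]] := invariant_state.
have [rho rhoE] := riesz_markov compactZ stateL.
pose G (g : X * Z -> R) :=
  \int[rho]_z \int[alpha]_x (expR (b (x, z)) * g (x, z)).
have stateG : state G.
  split.
  - move=> a f g cf cg; rewrite /G.
    under eq_Rintegral do rewrite fiber_integral_linear//.
    have i g' : continuous g' -> rho.-integrable [set: borel Z]
        (EFin \o (fun z => \int[alpha]_x (expR (b (x, z)) * g' (x, z)))).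
      move=> cg'; apply: (continuous_integrable rho compactZ).
      exact: fiber_integral_continuous.
    rewrite RintegralD//; last 2 first.
    + exact: (integrableZl measurableT a (i f cf)).
    + exact: i.
    by rewrite RintegralZl//; exact: i.
  - move=> f cf f0; apply: Rintegral_ge0 => z _; exact: fiber_integral_ge0.
  - rewrite /G; under eq_Rintegral do rewrite fiber_integral_cst.
    exact: Rintegral_probability_cst.
have [p pE] := riesz_markov compactXZ stateG.
exists p; exists rho => // u cu; rewrite !rhoE//; first exact: invL.
exact: cP.
Qed.

Variable p : probability (borel (X * Z)) R.
Hypothesis assoc_p : holonomic_associated tau alpha b p.

(** Both sides equal the integral of [g] against [rho]: the left one by invariance of [rho], the
    right one because the weights [expR (b (x, z))] have mass [1] on each fiber. *)
Lemma holonomic_associated_holonomic : holonomic tau p.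
Proof.
have [rho inv_rho pE] := assoc_p => g cg.
rewrite (pE _ (continuous_comp_ifs tau_contractive cg)).
rewrite (pE _ (continuous_comp_snd cg)) [LHS](inv_rho _ cg).
by apply: eq_Rintegral => z _; exact: (esym (fiber_integral_cst (g z) z)).
Qed.

(* Gibbs' inequality, from [1 + t <= expR t] at [t = b' - b]. *)
Lemma Rintegral_normalized_le (b' : X * Z -> R) :
  normalized tau alpha b' -> \int[p]_w b' w <= \int[p]_w b w.
Proof.
move=> norm_b'; have cb' : continuous b'.
  by have [lb' _] := norm_b'; exact: sum_lipschitz_continuous.
have cd : continuous (fun w => b' w - b w) by exact: continuousBr.
have ce : continuous (fun w => expR (b' w - b w) - 1).
  by apply: continuousBr; [exact: continuous_expR_comp|exact: continuous_cstr].
have ip (f : X * Z -> R) : continuous f ->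
    p.-integrable [set: borel (X * Z)] (EFin \o f).
  exact: (continuous_integrable p compactXZ).
have [rho _ pE] := assoc_p.
(* On the fiber over [z] the weighted integrand is [expR b' - expR b], a difference of two densities
   of mass [1]. *)
have e0 : \int[p]_w (expR (b' w - b w) - 1) = 0.
  rewrite (pE _ ce) -[RHS](Rintegral_probability_cst rho).
  apply: eq_Rintegral => z _.
  under eq_Rintegral do rewrite mulrBr mulr1 -expRD subrKC.
  rewrite RintegralB//.
  - rewrite (normalized_Rintegral_weight z norm_b).
    by rewrite (normalized_Rintegral_weight z norm_b') subrr.
  - apply: (continuous_integrable alpha compactX).
    exact: (continuous_pair1 (z := z) (continuous_expR_comp cb')).
  - apply: (continuous_integrable alpha compactX).
    exact: (continuous_pair1 (z := z) (continuous_expR_comp cb)).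
rewrite -subr_le0 -e0 -RintegralB//; [|exact: ip|exact: ip].
apply: le_Rintegral => //; [exact: ip|exact: ip|].
by move=> w _; rewrite lerBrDl expR_ge1Dx.
Qed.

Lemma entropy_holonomic_associated : entropy tau alpha p = (- \int[p]_w b w)%:E.
Proof.
rewrite /entropy EFinN; congr (- _)%E; apply/eqP; rewrite eq_le; apply/andP; split.
  apply: ge_ereal_sup => _ [b' norm_b' <-].
  by rewrite lee_fin; exact: Rintegral_normalized_le.
by apply: ereal_sup_ubound; exists b.
Qed.

End InvariantState.

(** Heine-Cantor, with the scale [d] tending to [0] from the right as the parameter of the
    compactness argument. *)
Lemma compact_uniformly_continuous (R : realType) (T : metricType R) (f : T -> R) :
  compact [set: T] -> continuous f ->
  forall e, 0 < e ->
  exists2 d, 0 < d & forall x y, mdist x y < d -> `|f x - f y| <= e.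
Proof.
move=> /compact_near_coveringP ncT cf e e0.
have e20 : 0 < e / 2 by rewrite divr_gt0.
have : \forall d \near (0 : R)^'+, [set: T] `<=`
    (fun x => forall y, mdist x y < d -> `|f x - f y| <= e).
  apply: ncT => x _.
  have /cvgrPdist_le/(_ _ e20) := cf x.
  rewrite /= -nbhs_ballE => -[r /= r0 fr].
  have r20 : 0 < r / 2 by rewrite divr_gt0.
  exists (ball x (r / 2), [set d | d < r / 2]).
    by split; [exact: nbhsx_ballx|exact: nbhs_right_lt].
  move=> [x' d] /= [xx' dr] y x'y.
  have bx' : ball x r x' by apply: le_ball xx'; rewrite ler_pdivrMr// ler_pMr// ler1n.
  have bxy : ball x r y.
    rewrite [r]splitr; apply: ball_triangle xx' _.
    by rewrite ballEmdist /= (lt_trans x'y).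
  rewrite -(subrKA (f x)) (le_trans (ler_normD _ _))// distrC.
  by rewrite [leRHS]splitr lerD//; exact: fr.
move=> H; have [d [d0 fd]] := filter_ex (filterI (nbhs_right_gt (0 : R)) H).
by exists d => // x y; exact: fd.
Qed.

(** * Regularity of the eigenfunction, the normalized potential and the pressure *)

Section Eigenfunction.
Context {R : realType} {X Z : pmetricType R}.
Hypotheses (compactX : compact [set: X]) (compactZ : compact [set: Z]).
Variables (tau : X -> Z -> Z) (alpha : probability (borel X) R) (c : X * Z -> R).
Hypotheses (tau_contractive : uniformly_contractive tau)
  (c_lipschitz : sum_lipschitz c).
Variables (lambda : R) (h : Z -> R).
Hypothesis lambda_h : positive_eigenpair tau alpha c lambda h.

Let lambda_gt0 : 0 < lambda. Proof. by case: lambda_h. Qed.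
Let ch : continuous h. Proof. by case: lambda_h. Qed.
Let h_gt0 z : 0 < h z. Proof. by case: lambda_h. Qed.
Let cc : continuous c. Proof. exact: sum_lipschitz_continuous. Qed.

Let cln : continuous (fun z => ln (h z)).
Proof. exact: continuous_ln_comp. Qed.

Let integrable_eigen z :
  alpha.-integrable [set: borel X] (EFin \o (fun x => expR (c (x, z)) * h (tau x z))).
Proof.
apply: (continuous_integrable alpha compactX).
exact: (continuous_pair1 (z := z) (continuousMr (continuous_expR_comp cc)
  (continuous_comp_ifs tau_contractive ch))).
Qed.

(* With [w] the modulus of continuity of [ln \o h], the eigenvalue equation
   gives [w t <= K t + w (g t)]; iterating, [w t <= K t / (1 - g) + w (g ^ n t)]. *)
Lemma eigenfunction_ln_lipschitz : exists2 C, 0 <= C &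
  forall z1 z2, `|ln (h z1) - ln (h z2)| <= C * mdist z1 z2.
Proof.
have [g /andP[g0 g1] tg] := tau_contractive.
have [K cK] := c_lipschitz.
have g1' : 0 < 1 - g by rewrite subr_gt0.
(* The solution of [C = |K| + C * g]: one use of the eigenvalue equation reproduces the same
   constant. *)
pose C := `|K| / (1 - g).
have C0 : 0 <= C by rewrite divr_ge0// ltW.
have CE : C = `|K| + C * g by rewrite /C; field; rewrite gt_eqF.
have cz x z1 z2 : c (x, z1) <= c (x, z2) + `|K| * mdist z1 z2.
  rewrite addrC -lerBlDr (le_trans (ler_norm _))// (le_trans (cK _ _ _ _))//.
  by rewrite mdistxx add0r ler_wpM2r ?mdist_ge0// ler_norm.
have tz x z1 z2 : mdist (tau x z1) (tau x z2) <= g * mdist z1 z2.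
  by rewrite (le_trans (tg _ _ _ _))// mdistxx add0r.
(* A bound [e] on the oscillation of [ln \o h] at scale [d] is carried to pairs that [n]
   contractions bring within [d], with the additive error [e] unchanged. *)
have step e d n : 0 < e ->
    (forall z1 z2, mdist z1 z2 < d -> ln (h z1) - ln (h z2) <= e) ->
    forall z1 z2, g ^+ n * mdist z1 z2 < d ->
      ln (h z1) <= C * mdist z1 z2 + e + ln (h z2).
  move=> e0 he; elim: n => [z1 z2|n IH z1 z2 z12].
    rewrite expr0 mul1r => /he; rewrite -lerBlDr => /le_trans; apply.
    by rewrite lerDr mulr_ge0// mdist_ge0.
  set E := C * mdist z1 z2 + e.
  (* The integrands of the eigenvalue equation at [z1] and [z2] are compared pointwise in [x]: [c]
     costs [|K| * mdist z1 z2], the induction hypothesis costs [C * g * mdist z1 z2 + e], and the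
     total is [E]. *)
  have hE : h z1 <= expR E * h z2.
    rewrite -(ler_pM2l lambda_gt0) mulrCA.
    have [_ _ _ eig] := lambda_h; rewrite -!eig /transfer.
    rewrite -RintegralZl//; apply: le_Rintegral => //.
      exact: (integrableZl measurableT (expR E) (integrable_eigen z2)).
    move=> x _; rewrite -[h (tau x z1)]lnK ?posrE// -[h (tau x z2)]lnK ?posrE//.
    rewrite -!expRD ler_expR.
    apply: (le_trans (lerD (cz x z1 z2) (IH (tau x z1) (tau x z2) _))).
      by rewrite (le_lt_trans _ z12)// exprSr -mulrA ler_wpM2l// exprn_ge0// ltW.
    have : C * mdist (tau x z1) (tau x z2) <= C * (g * mdist z1 z2) by rewrite ler_wpM2l.
    have : E = `|K| * mdist z1 z2 + C * (g * mdist z1 z2) + e.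
      by rewrite /E {1}CE mulrDl !mulrA.
    by move=> -> ?; lra.
  rewrite -[E]expRK -lnM ?posrE ?expR_gt0// ler_ln ?posrE// mulr_gt0 ?expR_gt0//.
have main z1 z2 : ln (h z1) - ln (h z2) <= C * mdist z1 z2.
  apply/ler_addgt0Pr => e e0.
  have [d d0 hd] := compact_uniformly_continuous compactZ cln e0.
  have [n nd] : exists n, g ^+ n * mdist z1 z2 < d.
    have ng1 : `|g| < 1 by rewrite ger0_norm// ltW.
    have /cvgrPdist_lt/(_ d d0)[n _ /(_ n (leqnn n))] := cvg_geometric (mdist z1 z2) ng1.
    rewrite /= sub0r normrN mulrC => nd; exists n.
    by rewrite (le_lt_trans (ler_norm _)).
  rewrite lerBlDr; apply: (step e d n) => // y1 y2 /hd.
  exact/le_trans/ler_norm.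
exists C => // z1 z2; rewrite ler_norml main andbT -lerN2 opprK opprB.
by rewrite metric_sym main.
Qed.

Let cnorm : X * Z -> R := normalization tau c lambda h.

Lemma normalization_lipschitz : sum_lipschitz cnorm.
Proof.
have [C C0 hC] := eigenfunction_ln_lipschitz.
have [g /andP[g0 g1] tg] := tau_contractive.
have [K cK] := c_lipschitz.
(* The three terms bound the variations of [c], of [ln h] after [tau], and of [ln h]. *)
exists (K + C * g + C) => x1 x2 z1 z2.
rewrite /cnorm /normalization /=.
have -> : c (x1, z1) + ln (h (tau x1 z1)) - ln (h z1) - ln lambda -
    (c (x2, z2) + ln (h (tau x2 z2)) - ln (h z2) - ln lambda) =
    c (x1, z1) - c (x2, z2) + (ln (h (tau x1 z1)) - ln (h (tau x2 z2)))
    - (ln (h z1) - ln (h z2)) by ring.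
rewrite (le_trans (ler_normB _ _))// mulrDl lerD//.
  rewrite (le_trans (ler_normD _ _))// mulrDl lerD// -mulrA.
  by rewrite (le_trans (hC _ _))// ler_wpM2l.
rewrite (le_trans (hC _ _))// ler_wpM2l// lerDr mdist_ge0//.
Qed.

(** Exponentiating [cnorm] gives the integrand of [transfer tau alpha c h z] times
    [(h z * lambda)^-1], a factor independent of [x]; the eigenvalue equation then yields [1]. *)
Lemma normalization_normalized : normalized tau alpha cnorm.
Proof.
split; first exact: normalization_lipschitz.
move=> z; have [_ _ _ eig] := lambda_h.
have hl : h z * lambda != 0 by rewrite mulf_neq0 ?gt_eqF.
transitivity ((h z * lambda)^-1 * transfer tau alpha c h z).
  rewrite -RintegralZl//; apply: eq_Rintegral => x _.
  rewrite mulr1 /cnorm /normalization /= !expRB expRD.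
  by rewrite !lnK ?posrE// [RHS]mulrC invfM mulrA.
by rewrite eig [lambda * _]mulrC mulVf.
Qed.

Let compactXZ : compact [set: X * Z].
Proof. by rewrite -setXTT; exact: compact_setX. Qed.

Lemma Rintegral_normalization (p : probability (borel (X * Z)) R) :
  holonomic tau p -> \int[p]_w cnorm w = \int[p]_w c w - ln lambda.
Proof.
move=> hol_p.
have ip (f : X * Z -> R) : continuous f ->
    p.-integrable [set: borel (X * Z)] (EFin \o f).
  exact: (continuous_integrable p compactXZ).
have c1 := continuous_comp_ifs tau_contractive cln.
have c2 := @continuous_comp_snd R X Z _ cln.
rewrite /cnorm /normalization.
rewrite RintegralB//; last 2 first.
- by apply: ip; apply: continuousBr => //; exact: continuousDr.
- by apply: ip; exact: continuous_cstr.
rewrite RintegralB//; last 2 first.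
- by apply: ip; exact: continuousDr.
- exact: ip.
rewrite RintegralD//; last 2 first.
- exact: ip.
- exact: ip.
by rewrite (hol_p _ cln) addrK Rintegral_probability_cst.
Qed.

Lemma pressure_le : (pressure tau alpha c <= (ln lambda)%:E)%E.
Proof.
apply: ge_ereal_sup => _ [p hol_p <-].
(* In this form the integral of [c] cancels and only the competitor [cnorm] in the supremum of the
   entropy remains. *)
have -> : ln lambda = \int[p]_w c w - \int[p]_w cnorm w.
  by rewrite Rintegral_normalization// opprB addrC subrK.
rewrite EFinD leeD2lE// EFinN leeN2; apply: ereal_sup_ubound.
by exists cnorm => //; exact: normalization_normalized.
Qed.

Lemma pressure_holonomic_associated (p : probability (borel (X * Z)) R) :
  holonomic_associated tau alpha cnorm p ->
  ((\int[p]_w c w)%:E + entropy tau alpha p = (ln lambda)%:E)%E.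
Proof.
move=> assoc_p.
have norm_c := normalization_normalized.
have hol_p := holonomic_associated_holonomic compactX tau_contractive norm_c assoc_p.
rewrite (entropy_holonomic_associated compactX compactZ norm_c assoc_p).
by rewrite Rintegral_normalization// -EFinD opprB addrC subrK.
Qed.

Lemma pressure_eigenvalue : pressure tau alpha c = (ln lambda)%:E.
Proof.
apply/eqP; rewrite eq_le pressure_le /=.
have norm_c := normalization_normalized.
have [p assoc_p] :=
  normalized_holonomic_associated compactX compactZ tau_contractive norm_c.
rewrite -(pressure_holonomic_associated assoc_p); apply: ereal_sup_ubound.
exists p => //.
exact: (holonomic_associated_holonomic compactX tau_contractive norm_c assoc_p).
Qed.

End Eigenfunction.

Theorem theorem14 (R : realType) (X Z : pmetricType R)
    (compactX : compact [set: X]) (compactZ : compact [set: Z])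
    (tau : X -> Z -> Z) (tau_contractive : uniformly_contractive tau)
    (alpha : probability (borel X) R) (alpha_full : full_support alpha)
    (c : X * Z -> R) (c_lipschitz : sum_lipschitz c)
    (lambda : R) (h : Z -> R)
    (lambda_h : positive_eigenpair tau alpha c lambda h) :
  pressure tau alpha c = (ln lambda)%:E /\
  forall p : probability (borel (X * Z)) R,
    holonomic_associated tau alpha (normalization tau c lambda h) p ->
    pressure tau alpha c = ((\int[p]_w c w)%:E + entropy tau alpha p)%E.
Proof.
have pressureE : pressure tau alpha c = (ln lambda)%:E.
  exact: (pressure_eigenvalue compactX compactZ tau_contractive c_lipschitz
    lambda_h).
split=> // p assoc_p; rewrite pressureE.
by rewrite (pressure_holonomic_associated compactX compactZ tau_contractive
  c_lipschitz lambda_h assoc_p).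
Qed.
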